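(* Let $\alpha\in[0,1)$, let $G$ be a connected graph and $uv$ a non-pendant cut edge of $G$. Let $G_{uv}$ be the graph obtained from $G$ by identifying the vertices $u$ and $v$ to a vertex $v$ and attaching a (new) pendant vertex $u$ to $v$. If at least one of $u,v$ is a quasi-pendant vertex in $G$, then $\mu_{\alpha}(G)>\mu_{\alpha}(G_{uv})$.
   Context: All graphs are finite, simple and undirected; $d_G(u,v)$ is the distance between $u$ and $v$ in the connected graph $G$. A pendant vertex is a vertex of degree $1$; a quasi-pendant vertex is a neighbor of a pendant vertex. A non-pendant edge is an edge neither of whose end vertices is a pendant vertex. A cut edge of a connected graph is an edge whose removal disconnects the graph. Explicitly, $G_{uv}$ has the same vertex set as $G$, and is obtained by replacing every edge $uw$ of $G$ with $w\ne v$ by the edge $vw$ and keeping the edge $uv$. For a connected graph $G$, the transmission of a vertex $u$ is $T_G(u)=\sum_{v\in V(G)}d_G(u,v)$, $T(G)$ is the diagonal matrix of transmissions and $D(G)=(d_G(u,v))_{u,v\in V(G)}$ the distance matrix. For $\alpha\in[0,1)$, $D_{\alpha}(G)=\alpha T(G)+(1-\alpha)D(G)$, and $\mu_{\alpha}(G)$ (the distance $\alpha$-spectral radius) is the largest eigenvalue of the symmetric matrix $D_{\alpha}(G)$. *)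

(* Defs.v *)
From HB Require Import structures.
From mathcomp Require Import all_boot all_order all_algebra.
From mathcomp Require Import boolp classical_sets reals.

Set Implicit Arguments.
Unset Strict Implicit.
Unset Printing Implicit Defensive.

Import Order.TTheory GRing.Theory Num.Theory.
Local Open Scope ring_scope.

(* A finite simple undirected graph is its adjacency relation [e] on the
   finType [V] of its vertices. *)
Section Graphs.
Variable V : finType.
Implicit Types (e : rel V) (u v w x y : V).

Definition simple_graph e : Prop := symmetric e /\ irreflexive e.

Definition connected_graph e : bool := [forall x, forall y, connect e x y].

Definition degree e x : nat := #|[set y | e x y]|.

Definition pendant e x : bool := degree e x == 1%N.

Definition quasi_pendant e x : bool := [exists y, e x y && pendant e y].

(* {x, y} = {u, v} as unordered pairs *)
Definition same_pair u v x y : bool :=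
  (x == u) && (y == v) || (x == v) && (y == u).

Definition del_edge e u v : rel V :=
  [rel x y | e x y && ~~ same_pair u v x y].

Definition cut_edge e u v : bool :=
  e u v && ~~ connected_graph (del_edge e u v).

Definition non_pendant_edge e u v : bool :=
  [&& e u v, ~~ pendant e u & ~~ pendant e v].

(* The graph G_uv. An edge avoiding u, and the edge uv itself, are kept; an edge
   uw with w != v becomes vw (the last two disjuncts are its two
   orientations). *)
Definition contract_pendant e u v : rel V :=
  [rel x y | [|| e x y && [&& x != u & y != u],
                 e x y && same_pair u v x y,
                 [&& x == v, y != v & e u y]
               | [&& y == v, x != v & e u x]]].

Definition walk_of_length e x y (n : nat) : bool :=
  [exists p : n.-tuple V, path e x p && (last x p == y)].

(* The least length of a walk from x to y. A shortest walk repeats no vertex,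
   so only lengths below #|V| are searched; the value is #|V| if there is
   none, i.e. if x and y are not connected. *)
Definition gdist e x y : nat := find (walk_of_length e x y) (iota 0 #|V|).

Definition transmission e x : nat := (\sum_(y : V) gdist e x y)%N.

Lemma contract_pendant_simple e u v :
  simple_graph e -> simple_graph (contract_pendant e u v).
Proof.
move=> [eS eI]; split=> [x y|x]; rewrite /contract_pendant /=; last by rewrite eI; case: (x == v).
rewrite (eS y x) (andbC (y != u)) /same_pair.
by case: (x == u); case: (x == v); case: (y == u); case: (y == v);
   case: (e x y); case: (e u x); case: (e u y).
Qed.

Lemma gdist_path e x y : connect e x y ->
  exists p, [/\ path e x p, last x p = y & size p = gdist e x y].
Proof.
move=> /connectP[p0 /shortenP[p ep up _] yE].
have hasW : has (walk_of_length e x y) (iota 0 #|V|).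
  apply/hasP; exists (size p).
    by rewrite mem_iota /= add0n -[X in (X <= _)%N]/(size (x :: p))
      -(card_uniqP up) max_card.
  by apply/existsP; exists (in_tuple p); rewrite ep -yE eqxx.
have ltd : (gdist e x y < #|V|)%N by move: hasW; rewrite has_find size_iota.
have := nth_find 0%N hasW; rewrite -/(gdist e x y) nth_iota // add0n.
by move=> /existsP[q /andP[eq /eqP qy]]; exists q; rewrite size_tuple.
Qed.

Lemma gdist_le_path e x p : path e x p -> (gdist e x (last x p) <= size p)%N.
Proof.
move=> ep; rewrite /gdist.
case: (ltnP (size p) #|V|) => [ltp|]; last first.
  by apply: leq_trans; rewrite -[X in (_ <= X)%N](size_iota 0) find_size.
rewrite leqNgt; apply/negP => /(before_find 0%N); rewrite nth_iota // add0n.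
by move=> /negbT/negP; apply; apply/existsP; exists (in_tuple p); rewrite ep eqxx.
Qed.

End Graphs.

Section SpectralRadius.
Variables (R : realType) (V : finType).
Implicit Types (e : rel V) (alpha : R).

(* Matrices of a graph are indexed by 'I_#|V|, along the enumeration
   [enum_val] of V. *)
Definition transmission_mx e : 'M[R]_#|V| :=
  diag_mx (\row_i (transmission e (enum_val i))%:R).

Definition distance_mx e : 'M[R]_#|V| :=
  \matrix_(i, j) (gdist e (enum_val i) (enum_val j))%:R.

Definition distance_alpha_mx alpha e : 'M[R]_#|V| :=
  alpha *: transmission_mx e + (1 - alpha) *: distance_mx e.

Definition is_largest_eigenvalue n (A : 'M[R]_n) (a : R) : Prop :=
  eigenvalue A a /\ forall b, eigenvalue A b -> b <= a.

(* 0 if A has no real eigenvalue, which never happens for a symmetric A of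
   positive size. *)
Definition largest_eigenvalue n (A : 'M[R]_n) : R :=
  xget 0 [set a | is_largest_eigenvalue A a]%classic.

Definition mu alpha e : R := largest_eigenvalue (distance_alpha_mx alpha e).

End SpectralRadius.

(* Main.v *)
Require Import Defs.
From mathcomp Require Import all_boot all_order all_algebra.
From mathcomp Require Import perm.
From mathcomp Require Import boolp classical_sets reals.
From mathcomp Require Import topology normedtype derive.
From mathcomp Require Import ring lra zify.

Set Implicit Arguments.
Unset Strict Implicit.
Unset Printing Implicit Defensive.

Import Order.TTheory GRing.Theory Num.Theory.
Import numFieldNormedType.Exports.
Local Open Scope ring_scope.

(* Let w be a pendant neighbor of v (when only u has one, exchange u and v: G_uv
   and G_vu are isomorphic). For a positive vector f, f^T D_alpha f is the sum of
   d(x,y) (alpha f(x)^2 + (1 - alpha) f(x) f(y)) over all ordered pairs. Let A be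
   the component of u in G - uv. Passing from G_uv to G, the distance from any
   x in A \ {u} to a vertex outside A grows by 1, its distance to u drops by 1,
   and nothing else changes. In G_uv the vertices u and w are twins, so there is
   a Perron vector f of G_uv with f(u) = f(w). For this f the loss from the pair
   x, u is balanced by the gain from x, w, and the gain from x, v is left over.
   Hence f has a larger Rayleigh quotient in G than in G_uv. *)

(** * Quadratic forms, and the largest eigenvalue as the maximum of the Rayleigh quotient *)

Section Rayleigh.
Variables (R : realType) (n : nat).
Implicit Types (A : 'M[R]_n) (x : 'rV[R]_n).

Definition qform A x : R := (x *m A *m x^T) 0 0.

Definition sqnorm x : R := (x *m x^T) 0 0.

Lemma qformE A x : qform A x = \sum_i \sum_j A i j * (x 0 i * x 0 j).
Proof.
rewrite /qform mxE exchange_big /=; apply: eq_bigr => j _.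
rewrite !mxE mulr_suml; apply: eq_bigr => i _; ring.
Qed.

Lemma sqnormE x : sqnorm x = \sum_i x 0 i ^+ 2.
Proof. by rewrite /sqnorm mxE; apply: eq_bigr => i _; rewrite mxE expr2. Qed.

Lemma sqnorm_ge0 x : 0 <= sqnorm x.
Proof. by rewrite sqnormE sumr_ge0 // => i _; rewrite sqr_ge0. Qed.

Lemma sqnorm_eq0 x : (sqnorm x == 0) = (x == 0).
Proof.
rewrite sqnormE psumr_eq0; last by move=> i _; rewrite sqr_ge0.
apply/allP/eqP => [h|-> i _]; last by rewrite /= mxE expr0n /=.
apply/rowP => i; rewrite mxE; apply/eqP.
by have := h i (mem_index_enum i); rewrite /= sqrf_eq0.
Qed.

Lemma sqnorm_gt0 x : (0 < sqnorm x) = (x != 0).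
Proof. by rewrite lt_def sqnorm_ge0 andbT sqnorm_eq0. Qed.

Lemma qformZ A c x : qform A (c *: x) = c ^+ 2 * qform A x.
Proof. by rewrite /qform linearZ /= -!scalemxAl -scalemxAr !mxE; ring. Qed.

Lemma sqnormZ c x : sqnorm (c *: x) = c ^+ 2 * sqnorm x.
Proof. by rewrite /sqnorm linearZ /= -!scalemxAl -scalemxAr !mxE; ring. Qed.

Lemma qform_eigen A a x : x *m A = a *: x -> qform A x = a * sqnorm x.
Proof. by move=> xA; rewrite /qform xA -scalemxAl mxE. Qed.

Lemma qform_scalarB a A x : qform (a%:M - A) x = a * sqnorm x - qform A x.
Proof.
by rewrite /qform mulmxBr mulmxBl mul_mx_scalar -scalemxAl mxE mxE;
  congr (_ + _); rewrite mxE.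
Qed.

Lemma qform_scaled_add A x y c : A^T = A ->
  qform A (x + c *: y) =
    qform A x + c *+ 2 * (x *m A *m y^T) 0 0 + c ^+ 2 * qform A y.
Proof.
move=> sA; have yx : (y *m A *m x^T) 0 0 = (x *m A *m y^T) 0 0.
  by rewrite -[LHS]trace_mx11 -mxtrace_tr !trmx_mul trmxK sA mulmxA trace_mx11.
rewrite /qform linearD /= linearZ /= mulmxDr !mulmxDl -!scalemxAr -!scalemxAl.
move: yx; move: (x *m A *m x^T) (y *m A *m x^T) (x *m A *m y^T) (y *m A *m y^T).
by move=> M N P Q yx; rewrite !mxE yx; ring.
Qed.

(** A zero of a nonnegative form is a minimum: if [x *m A] were nonzero, a small step from [x]
    against it would make the form negative. *)
Lemma psd_null A x : A^T = A -> (forall y, 0 <= qform A y) ->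
  qform A x = 0 -> x *m A = 0.
Proof.
move=> sA pA x0; apply/eqP; rewrite -sqnorm_eq0.
set g := x *m A; set s := sqnorm g; set t := qform A g.
apply: contraT => s_neq0.
have s0 : 0 < s by rewrite lt_def s_neq0 sqnorm_ge0.
have t0 : 0 <= t by apply: pA.
(* At [x - c *: g] the form equals [c ^+ 2 * t - c *+ 2 * s]. The choice [c = s / (1 + t)] makes
   this negative and avoids dividing by [t], which may be 0. *)
have := pA (x + (- (s / (1 + t))) *: g).
rewrite qform_scaled_add // x0 -/g -/(sqnorm g) -/s -/t add0r {sA pA x0}.
have -> : - (s / (1 + t)) *+ 2 * s + (- (s / (1 + t))) ^+ 2 * t =
          - (s / (1 + t)) ^+ 2 * (2 + t) by field; lra.
rewrite leNgt mulNr oppr_lt0 mulr_gt0 ?exprn_gt0 ?divr_gt0 //; lra.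
Qed.

Lemma qform_continuous A : continuous (qform A).
Proof.
have cc i : continuous (fun y : 'rV[R]_n => y 0 i) by apply: coord_continuous.
rewrite (_ : qform A = fun x => \sum_i \sum_j A i j * (x 0 i * x 0 j)); last first.
  by apply: funext => x; rewrite qformE.
have csum (F : 'I_n -> 'rV[R]_n -> R) :
    (forall i, continuous (F i)) -> continuous (fun x => \sum_i F i x).
  by move=> cF; apply: continuous_big => //; exact: (@add_continuous R^o).
have cmul i j : continuous (fun x : 'rV[R]_n => A i j * (x 0 i * x 0 j)).
  move=> x; apply: (@continuousM _ _ (fun=> A i j) (fun x => x 0 i * x 0 j)).
    exact: cst_continuous.
  by apply: (@continuousM _ _ (fun x => x 0 i) (fun x => x 0 j)); exact: cc.
exact: csum (fun i => csum _ (cmul i)).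
Qed.

Lemma sqnorm_qform x : sqnorm x = qform 1%:M x.
Proof. by rewrite /qform mulmx1. Qed.

(** The unit sphere is compact and the form is continuous; homogeneity carries the bound from the
    sphere to all vectors. *)
Lemma qform_attains_max A : (0 < n)%N ->
  exists2 x, sqnorm x = 1 & forall y, qform A y <= qform A x * sqnorm y.
Proof.
move=> n0; pose S := [set x : 'rV[R]_n | sqnorm x = 1]%classic.
have S0 : (S !=set0)%classic.
  exists (delta_mx 0 (Ordinal n0)); rewrite /S /= sqnormE (bigD1 (Ordinal n0)) //=.
  rewrite big1 => [|i /negPf ni]; first by rewrite mxE !eqxx expr1n addr0.
  by rewrite mxE ni andbF expr0n.
have cS : compact S.
  apply: bounded_closed_compact; last first.
    rewrite (_ : S = qform 1%:M @^-1` [set 1])%classic; last first.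
      by apply/seteqP; split=> x; rewrite /S /= sqnorm_qform.
    apply: closed_comp => [x _|]; first exact: qform_continuous.
    exact: closed_eq.
  exists 1; split=> // M M1 x Sx; apply: le_trans (ltW M1).
  rewrite /Num.norm /= mx_normrE; apply: bigmax_le => // -[i j] _ /=.
  rewrite (ord1 i) -(@ler_sqr _ `|x 0 j|) ?nnegrE // expr1n real_normK ?num_real //.
  rewrite -Sx sqnormE (bigD1 j) //= lerDl sumr_ge0 // => k _; exact: sqr_ge0.
have [x xS xmax] := compact_EVT_max S0 cS (continuous_subspaceT (@qform_continuous A)).
exists x => [|y]; first by move: xS; rewrite inE.
have [->|y0] := eqVneq y 0; first by rewrite /qform /sqnorm !mul0mx mxE mulr0.
have ypos : 0 < sqnorm y by rewrite sqnorm_gt0.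
have := xmax ((Num.sqrt (sqnorm y))^-1 *: y).
rewrite inE /S /= sqnormZ qformZ exprVn sqr_sqrtr ?sqnorm_ge0 // mulVf ?gt_eqF //.
by move=> /(_ erefl); rewrite ler_pdivrMl // mulrC.
Qed.

Lemma largest_eigenvalue_unique A a b :
  is_largest_eigenvalue A a -> is_largest_eigenvalue A b -> a = b.
Proof. by move=> [ea ma] [eb mb]; apply/le_anti; rewrite ma // mb. Qed.

Variable A : 'M[R]_n.
Hypotheses (n_gt0 : (0 < n)%N) (symA : A^T = A).

(** The form of [a%:M - A] is nonnegative and vanishes at [x], so [psd_null] applies. *)
Lemma eigenvector_of_max a x : (forall y, qform A y <= a * sqnorm y) ->
  qform A x = a * sqnorm x -> x *m A = a *: x.
Proof.
move=> maxa xa; apply/esym/eqP; rewrite -subr_eq0 -mul_mx_scalar -mulmxBr.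
apply/eqP/psd_null => [|y|]; rewrite ?qform_scalarB ?subr_ge0 ?xa ?subrr //.
by rewrite linearB /= tr_scalar_mx symA.
Qed.

Lemma largest_eigenvalue_attained : exists2 x, x != 0 &
  qform A x = largest_eigenvalue A * sqnorm x /\
  forall y, qform A y <= largest_eigenvalue A * sqnorm y.
Proof.
have [x x1 xmax] := qform_attains_max A n_gt0.
have x0 : x != 0 by rewrite -sqnorm_gt0 x1.
suff -> : largest_eigenvalue A = qform A x by exists x => //; rewrite x1 mulr1.
have lx : is_largest_eigenvalue A (qform A x).
  split.
    by apply/eigenvalueP; exists x => //; apply: eigenvector_of_max; rewrite // x1 mulr1.
  move=> b /eigenvalueP[y /qform_eigen yb y0].
  by rewrite -(@ler_pM2r _ (sqnorm y)) ?sqnorm_gt0 // -yb.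
(* Since [lx] provides a largest eigenvalue, [xget] does not fall back on its default. *)
apply: (largest_eigenvalue_unique _ lx).
exact: (xgetPex 0 (ex_intro (is_largest_eigenvalue A) _ lx)).
Qed.

Lemma qform_le_largest_eigenvalue y : qform A y <= largest_eigenvalue A * sqnorm y.
Proof. by have [x _ [_]] := largest_eigenvalue_attained. Qed.

Lemma eigenvector_of_largest x : qform A x = largest_eigenvalue A * sqnorm x ->
  x *m A = largest_eigenvalue A *: x.
Proof. exact: eigenvector_of_max qform_le_largest_eigenvalue. Qed.

End Rayleigh.

(** * Elementary properties of the graph distance *)

Section Distance.
Variable V : finType.
Implicit Types (e : rel V) (x y z : V).

Lemma connected_graphP e : reflect (forall x y, connect e x y) (connected_graph e).
Proof. exact: (iffP 'forall_forallP). Qed.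

Lemma gdistxx e x : gdist e x x = 0%N.
Proof. by apply/eqP; rewrite -leqn0; apply: (@gdist_le_path _ e x [::]). Qed.

Lemma gdist_gt0 e x y : connected_graph e -> x != y -> (0 < gdist e x y)%N.
Proof.
move=> /connected_graphP/(_ x y)/gdist_path[p [_ py <-]].
by case: p py => [/= ->|]; rewrite ?eqxx.
Qed.

Lemma gdist_homo e1 e2 (h : V -> V) x y : connected_graph e1 ->
  {homo h : a b / e1 a b >-> e2 a b} -> (gdist e2 (h x) (h y) <= gdist e1 x y)%N.
Proof.
move=> /connected_graphP/(_ x y)/gdist_path[p [ep <- <-]] he.
by rewrite -last_map -(size_map h) gdist_le_path // (homo_path he).
Qed.

Lemma gdist_iso e1 e2 (h : V -> V) x y :
  connected_graph e1 -> connected_graph e2 -> involutive h ->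
  (forall a b, e2 (h a) (h b) = e1 a b) -> gdist e2 (h x) (h y) = gdist e1 x y.
Proof.
move=> c1 c2 hK he; apply/anti_leq/andP; split.
  by apply: gdist_homo => // a b; rewrite he.
rewrite -{1}(hK x) -{1}(hK y); apply: gdist_homo => // a b.
by rewrite -he !hK.
Qed.

Lemma gdistC e x y : connected_graph e -> symmetric e -> gdist e x y = gdist e y x.
Proof.
move=> /connected_graphP ce se; wlog suff: x y / (gdist e y x <= gdist e x y)%N.
  by move=> le; apply/anti_leq; rewrite !le.
have [p [ep <- <-]] := gdist_path (ce x y).
have : path e (last x p) (rev (belast x p)).
  by rewrite rev_path; apply: sub_path ep => a b; rewrite se.
move=> /gdist_le_path; rewrite size_rev size_belast.
by case: p {ep} => //= a p; rewrite rev_cons last_rcons.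
Qed.

Lemma gdist_edge e x y z : connected_graph e -> e x y ->
  (gdist e x z <= (gdist e y z).+1)%N.
Proof.
move=> /connected_graphP/(_ y z)/gdist_path[p [ep <- <-]] exy.
by apply: (@gdist_le_path _ e x (y :: p)); rewrite /= exy.
Qed.

End Distance.

(** * Comparison of the distances in G and in G_uv *)

Section Contraction.
Variables (V : finType) (e : rel V) (u v : V).
Hypotheses (simple_e : simple_graph e) (conn_e : connected_graph e) (euv : e u v).

Let e' := contract_pendant e u v.
Let contraction x := if x == u then v else x.
(** This is the component A of the overview: it contains [u] and, once uv is a cut edge, not [v]. *)
Let side : pred V := connect (del_edge e u v) u.

Lemma edge_neq x y : e x y -> x != y.
Proof. by apply: contraTneq => ->; rewrite (proj2 simple_e). Qed.

Let vu : v != u.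
Proof. by rewrite eq_sym edge_neq. Qed.

Lemma contraction_edge x y : e x y ->
  (contraction x == contraction y) || e' (contraction x) (contraction y).
Proof.
have [eS eI] := simple_e; rewrite /contraction /e' /contract_pendant /= => exy.
have [xu|xu] := eqVneq x u; have [yu|yu] := eqVneq y u.
- by rewrite eqxx.
- by move: exy; rewrite xu => ->; rewrite [v == y]eq_sym eqxx;
  case: (y == v); rewrite //= !orbT.
- by move: exy; rewrite yu eS => ->; rewrite eqxx; case: (x == v); rewrite //= !orbT.
by rewrite exy xu yu /= orbT.
Qed.

(** Steps along uv collapse under [contraction]. A walk that leaves [side] must take such a step, as
    no other edge leads out of [side]; hence its image is shorter by at least one. *)
Lemma contraction_path x p : path e x p -> exists q,
  [/\ path e' (contraction x) q, last (contraction x) q = contraction (last x p) &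
      (size q + (side x && ~~ side (last x p)) <= size p)%N].
Proof.
elim: p x => [|z p IH] x /=; first by exists [::]; rewrite andbN.
move=> /andP[exz /IH[q [eq lq sq]]].
(* A step along uv is saved in the image, and this pays for the boolean term whatever its value. Any
   other step keeps the walk in [side], so the induction hypothesis already accounts for the
   term. *)
have [samexz|dxz] := boolP (same_pair u v x z).
  have cxz : contraction x = contraction z.
    by move: samexz; rewrite /contraction => /orP[]/andP[/eqP-> /eqP->];
      rewrite eqxx; case: eqP => // ->.
  by exists q; rewrite cxz; split=> //; case: (_ && _); move: sq; lia.
have sxz : side x -> side z.
  by move=> /connect_trans; apply; apply: connect1; rewrite /del_edge /= exz dxz.
have sq1 : ((size q).+1 + (side x && ~~ side (last z p)) <= (size p).+1)%N.
  by case: (side x) sxz sq => [-> //|_] /=; lia.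
case/orP: (contraction_edge exz) => [/eqP cxz|exz'].
  by exists q; rewrite cxz; split=> //; move: sq1; lia.
by exists (contraction z :: q); rewrite /= exz'.
Qed.

Lemma contract_pendant_uv : e' u v.
Proof. by rewrite /e' /contract_pendant /= euv /same_pair !eqxx !orbT. Qed.

(** Each vertex is joined in G_uv to its image under [contraction] ([u] by the edge uv), and walks
    between images come from walks of G. *)
Lemma contract_pendant_connected : connected_graph e'.
Proof.
have [sym' _] := contract_pendant_simple u v simple_e.
have csym := sym_connect_sym sym'.
apply/connected_graphP => x y.
have xc z : connect e' z (contraction z).
  rewrite /contraction; case: eqP => [->|_] //; apply: connect1.
  exact: contract_pendant_uv.
apply: connect_trans (xc x) _; rewrite csym; apply: connect_trans (xc y) _; rewrite csym.
have /connected_graphP/(_ x y)/connectP[p ep ->] := conn_e.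
have [q [eq <- _]] := contraction_path ep.
by apply/connectP; exists q.
Qed.

Lemma gdist_contraction x y :
  (gdist e' (contraction x) (contraction y) + (side x && ~~ side y) <= gdist e x y)%N.
Proof.
have /connected_graphP/(_ x y)/gdist_path[p [ep <- <-]] := conn_e.
have [q [eq <- sq]] := contraction_path ep.
by apply: leq_trans sq; rewrite leq_add2r gdist_le_path.
Qed.

(* The distances that drop by one join [side] minus [u] to the complement of
   [side]; those that grow by one join [side] minus [u] to [u]. *)
Lemma gdist_contract_pendant x y :
  (gdist e' x y + (side x && (x != u)) * ~~ side y + (side y && (y != u)) * ~~ side x
   <= gdist e x y + (side x && (x != u)) * (y == u) + (side y && (y != u)) * (x == u))%N.
Proof.
have [eS _] := simple_e; have [eS' _] := contract_pendant_simple u v simple_e.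
have c' := contract_pendant_connected.
have side_u : side u by apply: connect0.
(* The claim is symmetric in [x] and [y], so [y] can be taken different from [u]; the case where
   both are [u] is trivial. *)
wlog suff H : x y / y != u ->
  (gdist e' x y + (side x && (x != u)) * ~~ side y + side y * ~~ side x
   <= gdist e x y + side y * (x == u))%N.
  have [yu|yu] := eqVneq y u; last first.
    by rewrite andbT muln0 addn0; apply: H.
  have [xu|xu] := eqVneq x u; first by rewrite xu yu !gdistxx !andbF.
  rewrite andbT andbF !mul0n !addn0 [gdist e' _ _]gdistC // [gdist e _ _]gdistC //.
  have := H y x xu; rewrite yu eqxx andbF side_u /=.
  by rewrite mul0n !muln0 !addn0 muln1.
(* Both directions are used because the saved step appears only for walks that leave [side]. *)
move=> yu; have gxy := gdist_contraction x y; have gyx := gdist_contraction y x.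
have [xu|xu] := eqVneq x u; last first.
  move: gxy gyx; rewrite /contraction (negPf xu) (negPf yu) andbT muln0 addn0.
  rewrite [gdist e' y x]gdistC // [gdist e y x]gdistC //.
  by case: (side x); case: (side y) => /=; lia.
(* Now [x] is [u], whose image is [v]. Returning from [v] to the pendant [u] costs one step: the
   permitted growth if [y] is in [side], and the step saved by leaving [side] otherwise. *)
move: gxy; rewrite xu side_u /contraction eqxx (negPf yu) => gxy.
have := gdist_edge y c' contract_pendant_uv; rewrite -/e'.
by case: (side y) gxy => /=; lia.
Qed.

End Contraction.

(** * Cut edges, pendant vertices and symmetries of G_uv *)

Section CutEdge.
Variables (V : finType) (e : rel V) (u v : V).
Hypotheses (simple_e : simple_graph e) (conn_e : connected_graph e).

(** A walk from [u] to [v] avoiding uv could replace every use of uv, so deleting uv would leave G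
    connected. *)
Lemma cut_edge_side : cut_edge e u v -> ~~ connect (del_edge e u v) u v.
Proof.
have [eS _] := simple_e.
move=> /andP[euv]; apply: contraNN => cuv.
have symd : symmetric (del_edge e u v).
  by move=> a b; rewrite /del_edge /= eS /same_pair orbC (andbC (a == v)) (andbC (a == u)).
apply/connected_graphP => x y; have /connected_graphP/(_ x y) := conn_e.
apply: connect_sub => a b eab.
have [/orP[]/andP[/eqP-> /eqP->] //|dab] := boolP (same_pair u v a b).
  by rewrite (sym_connect_sym symd).
by apply: connect1; rewrite /del_edge /= eab dab.
Qed.

(** This supplies the vertex of A other than [u] from which strictness comes. *)
Lemma non_pendant_other_neighbor : e u v -> ~~ pendant e u ->
  exists2 z, z != v & e u z.
Proof.
move=> euv; rewrite /pendant /degree => pu.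
suff /exists_inP : [exists (z | z != v), e u z] by [].
apply: contraNT pu => /exists_inPn h; apply/eqP.
rewrite (_ : [set y | e u y] = [set v]) ?cards1 //.
apply/setP => z; rewrite !inE; have [->|zv] := eqVneq z v; first by rewrite euv.
by apply/negbTE/h.
Qed.

Lemma pendant_neighbor w y : pendant e w -> e w v -> e w y = (y == v).
Proof.
rewrite /pendant /degree => /cards1P[z /setP hz] ewv.
have := hz y; have := hz v; rewrite !inE ewv => /esym/eqP->; exact.
Qed.

(* In the contracted graph both [u] and the pendant vertex [w] hang on [v]. *)
Lemma contract_pendant_twins w x y : e u v -> e w v -> pendant e w -> w != u ->
  contract_pendant e u v (tperm u w x) (tperm u w y) = contract_pendant e u v x y.
Proof.
move=> euv ewv pw wu; have [eS eI] := simple_e.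
have nu z : contract_pendant e u v u z = (z == v).
  rewrite /contract_pendant /same_pair /= eqxx eI !andbF /=.
  have -> : (u == v) = false by apply: contraTF euv => /eqP->; rewrite eI.
  by rewrite /= orbF; case: eqP => [->|]; rewrite ?euv ?andbF.
have euw : e u w = false.
  rewrite eS (pendant_neighbor _ pw ewv).
  by apply: contraTF euv => /eqP->; rewrite eI.
have nw z : contract_pendant e u v w z = (z == v).
  rewrite /contract_pendant /same_pair /= (negPf wu) (pendant_neighbor _ pw ewv) euw.
  have -> : (w == v) = false by apply: contraTF ewv => /eqP->; rewrite eI.
  rewrite !andbF /= !orbF; case: eqP => //= ->.
  by apply: contraTN euv => /eqP->; rewrite eI.
have tw a b : contract_pendant e u v (tperm u w a) b = contract_pendant e u v a b.
  by case: tpermP => // ->; rewrite nu nw.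
have [eS' _] := contract_pendant_simple u v simple_e.
by rewrite tw eS' tw eS'.
Qed.

(** G_uv and G_vu differ only in which of the two vertices becomes pendant. This isomorphism reduces
    the case of a quasi-pendant [u] to that of [v]. *)
Lemma contract_pendant_swap x y : e u v ->
  contract_pendant e u v (tperm u v x) (tperm u v y) = contract_pendant e v u x y.
Proof.
move=> euv; have [eS eI] := simple_e.
have uv : (u == v) = false by apply: contraTF euv => /eqP->; rewrite eI.
have vu : (v == u) = false by rewrite eq_sym.
have evu : e v u by rewrite eS.
rewrite /contract_pendant /same_pair /=.
case: (tpermP u v x) => [->|->|/eqP/negPf xu /eqP/negPf xv];
  case: (tpermP u v y) => [->|->|/eqP/negPf yu /eqP/negPf yv];
  rewrite ?eqxx ?uv ?vu ?xu ?xv ?yu ?yv ?eI ?euv ?evu //= ?andbF ?andbT ?orbF //.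
- exact: orbC.
- by rewrite orbC (eS x) (eS x).
Qed.

End CutEdge.

(** * The quadratic form of the distance matrix and its positive eigenvectors *)

Section AlphaForm.
Variables (R : realType) (V : finType) (alpha : R).
Implicit Types (e : rel V) (f g : V -> R).

(** Transmissions are expanded into distances, which makes the form linear in the distances and
    allows a comparison pair by pair. *)
Definition alpha_form e f : R :=
  \sum_x \sum_y (gdist e x y)%:R * (alpha * f x ^+ 2 + (1 - alpha) * (f x * f y)).

Let vec f : 'rV[R]_#|V| := \row_i f (enum_val i).

Lemma sum_enum_val (F : V -> R) : \sum_(i < #|V|) F (enum_val i) = \sum_x F x.
Proof.
rewrite (reindex_onto enum_rank enum_val) /=; last by move=> i _; rewrite enum_valK.
by apply: eq_big => x; rewrite enum_rankK ?eqxx.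
Qed.

Lemma sqnorm_vec f : sqnorm (vec f) = \sum_x f x ^+ 2.
Proof.
rewrite sqnormE -(sum_enum_val (fun x => f x ^+ 2)).
by apply: eq_bigr => i _; rewrite mxE.
Qed.

Lemma mulmx_distance_alpha e f x : connected_graph e -> symmetric e ->
  (vec f *m distance_alpha_mx alpha e) 0 (enum_rank x) =
  \sum_y (gdist e x y)%:R * (alpha * f x + (1 - alpha) * f y).
Proof.
move=> ce se; rewrite /distance_alpha_mx mulmxDr -!scalemxAr /transmission_mx.
rewrite mul_mx_diag !mxE enum_rankK /transmission natr_sum.
rewrite -(sum_enum_val (fun y => (gdist e x y)%:R * (alpha * f x + (1 - alpha) * f y))).
rewrite -(sum_enum_val (fun y => (gdist e x y)%:R)).
rewrite !mulr_sumr -big_split /=; apply: eq_bigr => j _.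
by rewrite !mxE enum_rankK (gdistC _ _ ce se); ring.
Qed.

Lemma qform_vec e f : connected_graph e -> symmetric e ->
  qform (distance_alpha_mx alpha e) (vec f) = alpha_form e f.
Proof.
move=> ce se; rewrite /qform mxE /alpha_form.
rewrite -(sum_enum_val (fun x => \sum_y _)); apply: eq_bigr => i _.
rewrite -{1}(enum_valK i) mulmx_distance_alpha // mulr_suml.
by apply: eq_bigr => y _; rewrite !mxE; ring.
Qed.

Lemma distance_alpha_sym e : connected_graph e -> symmetric e ->
  (distance_alpha_mx alpha e)^T = distance_alpha_mx alpha e.
Proof.
move=> ce se; rewrite /distance_alpha_mx linearD !linearZ /= tr_diag_mx.
by congr (_ + _ *: _); apply/matrixP => i j; rewrite !mxE gdistC.
Qed.

Lemma alpha_form_le_mu e f : connected_graph e -> symmetric e ->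
  alpha_form e f <= mu alpha e * \sum_x f x ^+ 2.
Proof.
move=> ce se; rewrite -qform_vec // -sqnorm_vec.
(* With no vertices both sides are 0, whatever the value of [mu]. *)
case: (posnP #|V|) => [V0|V0]; last first.
  exact: qform_le_largest_eigenvalue (distance_alpha_sym ce se) _.
by rewrite sqnorm_vec qform_vec // /alpha_form !big_pred0 ?mulr0 // => x;
  have := max_card (pred1 x); rewrite V0 card1.
Qed.

(** Only the eigenvalue equation, row by row, so that solutions can be added and composed with
    symmetries; positivity comes from [perron_gt0]. *)
Definition perron e f : Prop := forall x,
  \sum_y (gdist e x y)%:R * (alpha * f x + (1 - alpha) * f y) = mu alpha e * f x.

Lemma perron_of_max e f : connected_graph e -> symmetric e -> (0 < #|V|)%N ->
  alpha_form e f = mu alpha e * \sum_x f x ^+ 2 -> perron e f.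
Proof.
move=> ce se V0; rewrite -qform_vec // -sqnorm_vec.
move=> /(eigenvector_of_largest V0 (distance_alpha_sym ce se)) h x.
by rewrite -mulmx_distance_alpha // h !mxE enum_rankK.
Qed.

Lemma max_of_perron e f : perron e f ->
  alpha_form e f = mu alpha e * \sum_x f x ^+ 2.
Proof.
move=> pf; rewrite mulr_sumr; apply: eq_bigr => x _.
rewrite [X in _ = _ * X]expr2 [RHS]mulrA -pf mulr_suml; apply: eq_bigr => y _; ring.
Qed.

Lemma perron_comp e (h : V -> V) f : involutive h ->
  (forall x y, gdist e (h x) (h y) = gdist e x y) -> perron e f -> perron e (f \o h).
Proof.
move=> hK hd pf x; rewrite -[RHS]pf (reindex_inj (inv_inj hK)) /=.
by apply: eq_bigr => y _; rewrite hK -hd hK.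
Qed.

Lemma perronD e f g : perron e f -> perron e g -> perron e (f \+ g).
Proof.
move=> pf pg x; rewrite /= [RHS]mulrDr -pf -pg -big_split /=.
by apply: eq_bigr => y _; ring.
Qed.

(** At a zero [x] of [f] the equation says that the nonnegative terms [d(x,y) (1 - alpha) f(y)] sum
    to 0. As [alpha < 1] and distances between distinct vertices are positive, [f] would vanish
    everywhere. *)
Lemma perron_gt0 e f : 0 <= alpha < 1 -> connected_graph e ->
  perron e f -> (forall x, 0 <= f x) -> (exists x, 0 < f x) -> forall x, 0 < f x.
Proof.
move=> /andP[_ a1] ce pf f0 [y fy] x.
rewrite lt_def f0 andbT; apply: contraTneq fy => fx; rewrite -leNgt.
have [<-|xy] := eqVneq x y; first by rewrite fx.
have := pf x; rewrite fx !mulr0 => /eqP.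
under eq_bigr do rewrite add0r.
rewrite psumr_eq0 => [/allP/(_ y (mem_index_enum y))|z _]; last first.
  by rewrite mulr_ge0 ?ler0n // mulr_ge0 ?f0 // subr_ge0 ltW.
by rewrite /= !mulf_eq0 pnatr_eq0 eqn0Ngt (gdist_gt0 ce xy) subr_eq0 (gt_eqF a1) => /eqP->.
Qed.

Lemma alpha_form_norm e f : alpha <= 1 ->
  alpha_form e f <= alpha_form e (fun x => `|f x|).
Proof.
move=> a1; apply: ler_sum => x _; apply: ler_sum => y _.
rewrite real_normK ?num_real // ler_wpM2l // lerD2l ler_wpM2l ?subr_ge0 //.
by rewrite -normrM ler_norm.
Qed.

(** The absolute value of a maximizer is again a maximizer, hence an eigenvector. Adding its
    composition with the involution [h] makes it invariant, and [perron_gt0] makes the sum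
    positive. *)
Lemma perron_invariant e (h : V -> V) : 0 <= alpha < 1 ->
  connected_graph e -> symmetric e -> (0 < #|V|)%N -> involutive h ->
  (forall x y, gdist e (h x) (h y) = gdist e x y) ->
  exists f, [/\ perron e f, forall x, 0 < f x & forall x, f (h x) = f x].
Proof.
move=> a01 ce se V0 hK hd.
have [_ /ltW a1] := andP a01.
have [x x0 [xmax _]] := largest_eigenvalue_attained V0 (distance_alpha_sym ce se).
pose f0 y := x 0 (enum_rank y); pose f y := `|f0 y|.
have xE : x = vec f0 by apply/rowP => i; rewrite mxE /f0 enum_valK.
have sumf : \sum_y f y ^+ 2 = \sum_y f0 y ^+ 2.
  by apply: eq_bigr => y _; rewrite real_normK ?num_real.
have pf : perron e f.
  apply: perron_of_max => //; apply/le_anti; rewrite alpha_form_le_mu //=.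
  rewrite sumf -sqnorm_vec -xE -[mu _ _ * _]xmax xE qform_vec //.
  exact: alpha_form_norm.
have [y fy] : exists y, 0 < f y.
  have [[i xi]|xi] := pselect (exists i, x 0 i != 0).
    by exists (enum_val i); rewrite /f /f0 enum_valK normr_gt0.
  case/negP: x0; apply/eqP/rowP => i; rewrite mxE; apply/eqP.
  by apply: contraT => xi0; case: xi; exists i.
exists (f \+ (f \o h)); split.
- exact: perronD pf (perron_comp hK hd pf).
- apply: (perron_gt0 a01 ce (perronD pf (perron_comp hK hd pf))) => [z|].
    by rewrite /= addr_ge0 /f.
  by exists y; rewrite /= ltr_pwDl // normr_ge0.
- by move=> z; rewrite /= hK addrC.
Qed.

Lemma mu_le_iso e1 e2 (h : V -> V) : 0 <= alpha < 1 ->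
  connected_graph e1 -> symmetric e1 -> connected_graph e2 -> symmetric e2 ->
  (0 < #|V|)%N -> involutive h ->
  (forall x y, e2 (h x) (h y) = e1 x y) -> mu alpha e1 <= mu alpha e2.
Proof.
move=> a01 c1 s1 c2 s2 V0 hK he.
(* The involution is the identity here: only a positive eigenvector is wanted, to be transported as
   a test vector for [e2]. *)
have [f [pf f0 _]] := perron_invariant a01 c1 s1 V0 (fun x : V => erefl x) (fun _ _ => erefl).
have [x _] := card_gt0P V0.
have N0 : 0 < \sum_x f x ^+ 2.
  rewrite (bigD1 x) //= ltr_pwDl ?exprn_gt0 // sumr_ge0 // => y _; exact: sqr_ge0.
rewrite -(ler_pM2r N0) -max_of_perron //.
have -> : alpha_form e1 f = alpha_form e2 (f \o h).
  rewrite /alpha_form (reindex_inj (inv_inj hK)); apply: eq_bigr => a _.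
  rewrite (reindex_inj (inv_inj hK)); apply: eq_bigr => b _.
  by rewrite -(gdist_iso _ _ c1 c2 hK he) !hK.
apply: le_trans (alpha_form_le_mu _ c2 s2) _.
by rewrite [X in _ <= _ * X](reindex_inj (inv_inj hK)).
Qed.

End AlphaForm.

(** * The strict inequality, first for a quasi-pendant [v], then in general *)

Lemma mu_contract_pendant_lt (R : realType) (V : finType) (alpha : R)
    (e : rel V) (u v : V) :
  0 <= alpha < 1 -> simple_graph e -> connected_graph e ->
  non_pendant_edge e u v -> cut_edge e u v -> quasi_pendant e v ->
  mu alpha (contract_pendant e u v) < mu alpha e.
Proof.
move=> a01 se ce /and3P[euv pu pv] cut /existsP[w /andP[evw pw]].
have [a0 a1] := andP a01.
have [eS eI] := se; have ewv : e w v by rewrite eS.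
have wu : w != u by apply: contraNneq pu => <-.
have V0 : (0 < #|V|)%N by apply/card_gt0P; exists u.
have ce' := contract_pendant_connected se ce euv.
have [eS' _] := contract_pendant_simple u v se.
have vside := cut_edge_side se ce cut.
have wside : ~~ connect (del_edge e u v) u w.
  apply: contraNN vside => /connect_trans; apply; apply: connect1.
  rewrite /del_edge /= ewv /same_pair (negPf wu) /= (_ : (w == v) = false) //.
  by apply: contraTF ewv => /eqP->; rewrite eI.
have wv : w != v by apply: contraTneq ewv => ->; rewrite eI.
have [z zv euz] := non_pendant_other_neighbor euv pu.
have zu : z != u by apply: contraTneq euz => ->; rewrite eI.
(* Indicators of A minus [u], of the pair [v], [w], and of [u]. Gains at other vertices outside A
   are discarded, so [b] stands in for the complement of A. *)
pose a x : nat := connect (del_edge e u v) u x && (x != u).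
pose b x := ((x == v) + (x == w))%N.
pose c x : nat := x == u.
have az : a z = 1%N.
  rewrite /a zu andbT; suff -> : connect (del_edge e u v) u z by [].
  by apply: connect1; rewrite /del_edge /= euz /same_pair eqxx (negPf zv) (negPf zu) !andbF.
have dle x y : (gdist (contract_pendant e u v) x y + a x * b y + a y * b x
    <= gdist e x y + a x * c y + a y * c x)%N.
  apply: leq_trans (gdist_contract_pendant se ce euv x y).
  rewrite -!addnA leq_add2l /a /b.
  have bs t : ((t == v) + (t == w) <= ~~ connect (del_edge e u v) u t)%N.
    have [->|_] := eqVneq t v; first by rewrite vside eq_sym (negPf wv).
    by have [->|_] := eqVneq t w; rewrite ?wside.
  by apply: leq_add; rewrite leq_mul2l bs orbT.
have [f [pf f0 finv]] := perron_invariant a01 ce' eS' V0 (@tpermK _ u w)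
  (fun x y => gdist_iso x y ce' ce' (@tpermK _ u w)
    (fun x y => contract_pendant_twins se x y euv ewv pw wu)).
have fw : f w = f u by rewrite -(finv u) tpermL.
pose k x y := alpha * f x ^+ 2 + (1 - alpha) * (f x * f y).
have k0 x y : 0 <= k x y.
  by rewrite /k; rewrite addr_ge0 ?mulr_ge0 ?sqr_ge0 ?subr_ge0 ?(ltW a1) ?(ltW (f0 _)).
have N0 : 0 < \sum_x f x ^+ 2.
  rewrite (bigD1 u) //= ltr_pwDl ?exprn_gt0 // sumr_ge0 // => y _; exact: sqr_ge0.
rewrite -(ltr_pM2r N0) -max_of_perron //.
apply: lt_le_trans (alpha_form_le_mu _ _ ce eS).
(* The weight [k] is not symmetric in its arguments; [K] collects both orders of a pair. *)
pose K x y := k x y + k y x.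
have Kpos : 0 < \sum_x (a x)%:R * K x v.
  rewrite (bigD1 z) //= az mul1r ltr_pwDl //; last first.
    by rewrite sumr_ge0 // => x _; rewrite mulr_ge0 // addr_ge0.
  rewrite /K /k; have := mulr_gt0 (f0 z) (f0 v); move: (sqr_ge0 (f z)) (sqr_ge0 (f v)).
  by case/andP: a01; nra.
have pick (F : V -> R) t : \sum_x (x == t)%:R * F x = F t.
  rewrite (bigD1 t) //= eqxx mul1r big1 ?addr0 // => x /negPf->; exact: mul0r.
(* The twins satisfy [f w = f u], so the terms [K x w] and [K x u] cancel and [K x v] remains. *)
have row x : \sum_y ((b y)%:R - (c y)%:R) * K x y = K x v.
  under eq_bigr => y _ do rewrite natrD mulrBl mulrDl.
  by rewrite sumrB big_split /= !pick /K /k fw; ring.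
apply: lt_le_trans (_ : alpha_form alpha (contract_pendant e u v) f +
   \sum_x (a x)%:R * K x v <= _); first by rewrite ltrDl.
(* The surplus is spread back over ordered pairs, with exactly the coefficients of [dle], so the
   final comparison is termwise. *)
have -> : \sum_x (a x)%:R * K x v =
    \sum_x \sum_y ((a x)%:R * ((b y)%:R - (c y)%:R) +
      (a y)%:R * ((b x)%:R - (c x)%:R)) * k x y.
  under [RHS]eq_bigr => x _ do (under eq_bigr => y _ do rewrite mulrDl; rewrite big_split /=).
  rewrite big_split /= [X in _ + X]exchange_big /= -big_split /=.
  apply: eq_bigr => x _; rewrite -big_split -row mulr_sumr /=.
  by apply: eq_bigr => y _; rewrite /K; ring.
rewrite -big_split; apply: ler_sum => x _; rewrite -big_split; apply: ler_sum => y _ /=.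
rewrite -/(k x y) -mulrDl ler_wpM2r //.
by have := dle x y; move: (b x) (b y) => bx b_y; rewrite -(ler_nat R) !natrD !natrM; lra.
Qed.

Theorem theorem4p1 (R : realType) (alpha : R) (V : finType) (e : rel V) (u v : V)
    (halpha : 0 <= alpha < 1)
    (hsimple : simple_graph e)
    (hconn : connected_graph e)
    (hnonpendant : non_pendant_edge e u v)
    (hcut : cut_edge e u v)
    (hquasi : quasi_pendant e u || quasi_pendant e v) :
  mu alpha e > mu alpha (contract_pendant e u v).
Proof.
have /and3P[euv pu pv] := hnonpendant; have [eS _] := hsimple.
case/orP: hquasi => [qu|]; last exact: mu_contract_pendant_lt.
have evu : e v u by rewrite eS.
(* With [u] quasi-pendant, the result is applied to G_vu, and the isomorphism bounds [mu] of G_uv by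
   that of G_vu. *)
apply: (@le_lt_trans _ _ (mu alpha (contract_pendant e v u))); last first.
  apply: mu_contract_pendant_lt => //; first by rewrite /non_pendant_edge evu pv.
  move: hcut; rewrite /cut_edge euv evu /=; apply: contraNN.
  move=> /connected_graphP h; apply/connected_graphP => x y.
  have := h x y; rewrite (@eq_connect _ _ (del_edge e u v)) // => a b.
  by rewrite /del_edge /same_pair /= orbC.
apply: (mu_le_iso halpha _ _ _ _ _ (@tpermK _ u v)).
- exact: contract_pendant_connected.
- exact: (proj1 (contract_pendant_simple _ _ hsimple)).
- exact: contract_pendant_connected.
- exact: (proj1 (contract_pendant_simple _ _ hsimple)).
- by apply/card_gt0P; exists u.
by move=> x y; rewrite tpermC contract_pendant_swap.
Qed.
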